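(* Let $\mathcal{GO}:[0,1]^2\to[0,1]$ be a bivariate general overlap function and let $N:[0,1]\to[0,1]$ be a fuzzy negation. Then the function $I:[0,1]^2\to[0,1]$ given by $I(x,y)=N(\mathcal{GO}(x,N(y)))$ (that is, any $(\mathcal{GO},N)$-implication) is a fuzzy implication.
   Context: A fuzzy negation is a map $N:[0,1]\to[0,1]$ with $N(0)=1$, $N(1)=0$ and $N(x)\le N(y)$ whenever $y\le x$. A bivariate general overlap function is a function $\mathcal{GO}:[0,1]^2\to[0,1]$ such that for all $x,y\in[0,1]$: (1) $\mathcal{GO}(x,y)=\mathcal{GO}(y,x)$; (2) if $xy=0$ then $\mathcal{GO}(x,y)=0$; (3) if $xy=1$ then $\mathcal{GO}(x,y)=1$; (4) $\mathcal{GO}$ is increasing (in the non-strict sense) in each variable; (5) $\mathcal{GO}$ is continuous. A fuzzy implication is a function $I:[0,1]^2\to[0,1]$ such that for all $x,y,z\in[0,1]$: (I1) $x\le z$ implies $I(x,y)\ge I(z,y)$; (I2) $y\le z$ implies $I(x,y)\le I(x,z)$; (I3) $I(0,y)=1$; (I4) $I(x,1)=1$; (I5) $I(1,0)=0$. *)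

(* Defs.v *)
From HB Require Import structures.
From mathcomp Require Import all_boot all_order all_algebra.
From mathcomp Require Import all_classical all_reals all_analysis.
Set Implicit Arguments.
Unset Strict Implicit.
Unset Printing Implicit Defensive.
Import Order.TTheory GRing.Theory Num.Theory.
Import numFieldNormedType.Exports.
Local Open Scope classical_set_scope.
Local Open Scope ring_scope.

(* Maps between powers of [0,1] are represented by total functions on R that
   send the unit interval (or square) into the unit interval; their values
   elsewhere are neither constrained nor used. *)

Definition unit_itv (R : realType) : set R := `[0, 1].

Definition unit_op2 (R : realType) (f : R -> R -> R) : Prop :=
  forall x y, unit_itv x -> unit_itv y -> unit_itv (f x y).

Record fuzzy_negation (R : realType) (N : R -> R) : Prop := FuzzyNegation {
  fneg_unit : set_fun (@unit_itv R) (@unit_itv R) N;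
  fneg0 : N 0 = 1;
  fneg1 : N 1 = 0;
  fneg_anti : forall x y, unit_itv x -> unit_itv y -> y <= x -> N x <= N y
}.

(* Continuity is joint: for the subspace topology of the unit square. *)
Record general_overlap (R : realType) (GO : R -> R -> R) : Prop :=
  GeneralOverlap {
  go_unit : unit_op2 GO;
  go_sym : forall x y, unit_itv x -> unit_itv y -> GO x y = GO y x;
  go_eq0 : forall x y, unit_itv x -> unit_itv y -> x * y = 0 -> GO x y = 0;
  go_eq1 : forall x y, unit_itv x -> unit_itv y -> x * y = 1 -> GO x y = 1;
  go_monol : forall x z y, unit_itv x -> unit_itv z -> unit_itv y ->
    x <= z -> GO x y <= GO z y;
  go_monor : forall x y z, unit_itv x -> unit_itv y -> unit_itv z ->
    y <= z -> GO x y <= GO x z;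
  go_continuous :
    {within @unit_itv R `*` @unit_itv R, continuous (fun p : R * R => GO p.1 p.2)}
}.

Record fuzzy_implication (R : realType) (I : R -> R -> R) : Prop :=
  FuzzyImplication {
  fimp_unit : unit_op2 I;
  fimp_anti : forall x y z, unit_itv x -> unit_itv y -> unit_itv z ->
    x <= z -> I z y <= I x y;
  fimp_mono : forall x y z, unit_itv x -> unit_itv y -> unit_itv z ->
    y <= z -> I x y <= I x z;
  fimp0l : forall y, unit_itv y -> I 0 y = 1;
  fimp1r : forall x, unit_itv x -> I x 1 = 1;
  fimp10 : I 1 0 = 0
}.

Definition GON_implication (R : realType) (GO : R -> R -> R) (N : R -> R)
    (I : R -> R -> R) : Prop :=
  forall x y, unit_itv x -> unit_itv y -> I x y = N (GO x (N y)).

(* Main.v *)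
Require Import Defs.
From HB Require Import structures.
From mathcomp Require Import all_boot all_order all_algebra.
From mathcomp Require Import all_classical all_reals all_analysis.

(** The composite [N (GO x (N y))] applies the antitone [N] once outside the
    isotone [GO], which makes it antitone in [x], and twice along [y], which
    makes it isotone there.  Each boundary value is forced by an extreme value
    of [GO]: when [x = 0], or when [y = 1] so that [N y = 0], the product
    [x * N y] vanishes, [GO] is [0] and [N 0 = 1]; at [(1, 0)] the product
    is [1], [GO] is [1] and [N 1 = 0]. *)

Import Order.TTheory GRing.Theory Num.Theory.
Local Open Scope ring_scope.

Lemma unit_itv0 (R : realType) : @unit_itv R 0.
Proof. by rewrite /unit_itv /= in_itv /= lexx ler01. Qed.

Lemma unit_itv1 (R : realType) : @unit_itv R 1.
Proof. by rewrite /unit_itv /= in_itv /= lexx ler01. Qed.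

Theorem proposition8 (R : realType) (GO : R -> R -> R) (N : R -> R)
    (I : R -> R -> R)
    (hGO : general_overlap GO) (hN : fuzzy_negation N)
    (hI : GON_implication GO N I) :
  fuzzy_implication I.
Proof.
have u0 := @unit_itv0 R; have u1 := @unit_itv1 R.
case: hGO => GOu _ GO0 GO1 GOl GOr _; case: hN => Nu N0 N1 Nanti.
have GONu x y : unit_itv x -> unit_itv y -> unit_itv (GO x (N y)).
  by move=> ux uy; apply: GOu => //; exact: Nu.
split.
- by move=> x y ux uy; rewrite hI //; apply: Nu; exact: GONu.
- move=> x y z ux uy uz xz; rewrite !hI //.
  by apply: Nanti; [exact: GONu..|apply: GOl => //; exact: Nu].
- move=> x y z ux uy uz yz; rewrite !hI //.
  apply: (Nanti); [exact: GONu..|].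
  by apply: GOr => //; [exact: Nu..|exact: Nanti].
- by move=> y uy; rewrite hI // GO0 ?mul0r //; exact: Nu.
- by move=> x ux; rewrite hI // N1 GO0 ?mulr0.
- by rewrite hI // N0 GO1 ?mulr1.
Qed.
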